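(* Let $0<\alpha<1$, let $N(t)=N_1(\Lambda(t))$ be the non-homogeneous Poisson process with intensity function $\lambda$, and let $Y_\alpha$ be the inverse stable subordinator independent of $N$. Then for all $s,t\in\mathbb{R}_+$ $$\begin{aligned}\mathrm{Cov}[N(Y_\alpha(s)),N(Y_\alpha(t))]&=\mathbb{E}\big[\mathrm{Cov}[N(Y_\alpha(s)),N(Y_\alpha(t))\mid Y_\alpha(s),Y_\alpha(t)]\big]\\&\quad+\mathrm{Cov}\big[\mathbb{E}[N(Y_\alpha(s))\mid Y_\alpha(s),Y_\alpha(t)],\,\mathbb{E}[N(Y_\alpha(t))\mid Y_\alpha(s),Y_\alpha(t)]\big]\\&=\mathbb{E}[\Lambda(0,Y_\alpha(s\wedge t))]+\mathrm{Cov}[\Lambda(Y_\alpha(s)),\Lambda(Y_\alpha(t))].\end{aligned}$$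
   Context: The intensity is a function $\lambda:[0,\infty)\to[0,\infty)$; for $0\le s\le t$, $\Lambda(s,t)=\int_s^t\lambda(u)\,\mathrm{d}u$ (assumed finite), and $\Lambda(t)=\Lambda(0,t)$. $N_1=\{N_1(t),t\ge 0\}$ is a homogeneous Poisson process with intensity $1$, independent of $Y_\alpha$. $L_\alpha=\{L_\alpha(t),t\ge 0\}$ is the $\alpha$-stable subordinator with $\mathbb{E}[\exp(-sL_\alpha(t))]=\exp(-ts^\alpha)$, $s\ge 0$, and its inverse is $Y_\alpha(t)=\inf\{u\ge 0: L_\alpha(u)>t\}$. $s\wedge t=\min(s,t)$. The moments involved are understood to exist, i.e. $\Lambda(Y_\alpha(s))$ and $\Lambda(Y_\alpha(t))$ have finite second moments. *)

(* Defs.v *)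
From mathcomp Require Import all_boot all_order all_algebra.
From mathcomp Require Import all_classical all_reals all_analysis.

Set Implicit Arguments.
Unset Strict Implicit.
Unset Printing Implicit Defensive.

Import Order.TTheory GRing.Theory Num.Theory.
Import numFieldNormedType.Exports.

Local Open Scope classical_set_scope.
Local Open Scope ring_scope.

(* Processes are indexed by R, but only the times t >= 0 are ever constrained
   or used. *)

Section processes.
Context {d : measure_display} {T : measurableType d} {R : realType}.
Variable P : probability T R.

(* Left limits are not listed: a nondecreasing path has them. *)
Record increasing_cadlag_from0 (x : R -> R) : Prop := {
  path_start0 : x 0 = 0;
  path_nondecreasing : forall s t : R, 0 <= s -> s <= t -> x s <= x t;
  path_right_continuous : forall t : R, 0 <= t -> x u @[u --> t^'+] --> x t }.

(* The product rule over all n increments gives mutual independence, since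
   B i = setT is allowed. *)
Definition independent_increments (X : R -> T -> R) : Prop :=
  forall (n : nat) (t : nat -> R) (B : nat -> set R),
    (forall i, 0 <= t i) -> (forall i, t i <= t i.+1) ->
    (forall i, measurable (B i)) ->
    P (\bigcap_(i < n) [set w | B i (X (t i.+1) w - X (t i) w)]) =
    (\prod_(i < n) P [set w | B i (X (t i.+1) w - X (t i) w)%R])%E.

Record unit_poisson_process (N1 : R -> {RV P >-> nat}) : Prop := {
  poisson_paths :
    forall w, increasing_cadlag_from0 (fun t => (N1 t w)%:R);
  poisson_independent_increments :
    independent_increments (fun t w => (N1 t w)%:R);
  poisson_increment_law : forall (s t : R) (k : nat), 0 <= s -> s < t ->
    P [set w | N1 t w = (N1 s w + k)%N] = (poisson_pmf (t - s) k)%:E }.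

Record stable_subordinator (alpha : R) (L : R -> {RV P >-> R}) : Prop := {
  subordinator_paths : forall w, increasing_cadlag_from0 (fun t => L t w);
  subordinator_independent_increments : independent_increments L;
  subordinator_stationary_increments :
    forall (s h : R) (B : set R), 0 <= s -> 0 <= h -> measurable B ->
      P [set w | B (L (s + h) w - L s w)] = P [set w | B (L h w)];
  subordinator_laplace : forall s t : R, 0 <= s -> 0 <= t ->
    ('E_P[fun w => expR (- (s * L t w))%R] =
     (expR (- (t * s `^ alpha))%R)%:E)%E }.

(* The set is nonempty for almost every w; on the exceptional null event the
   real-valued inf returns 0 instead of +oo. *)
Definition first_passage (L : R -> T -> R) (t : R) (w : T) : R :=
  inf [set u | 0 <= u /\ t < L u w].

Definition process_sigma d' (T' : measurableType d') (X : R -> T -> T') :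
    set (set T) :=
  <<s \bigcup_(t in [set t | 0 <= t]) preimage_set_system setT (X t) measurable >>.

Definition independent_processes d1 d2
    (T1 : measurableType d1) (T2 : measurableType d2)
    (X : R -> T -> T1) (Y : R -> T -> T2) : Prop :=
  forall A B, process_sigma X A -> process_sigma Y B ->
    P (A `&` B) = (P A * P B)%E.

End processes.

Section conditioning.
Context {d d' : measure_display} {T : measurableType d}.
Context {T' : measurableType d'} {R : realType}.
Variables (P : probability T R) (Z : T -> T').

Local Notation sigmaZ := (preimage_set_system [set: T] Z measurable).

Record is_cond_expectation (X f : T -> R) : Prop := {
  cond_expectation_measurable :
    forall B : set R, measurable B -> sigmaZ (f @^-1` B);
  cond_expectation_integrable : P.-integrable setT (EFin \o f);
  cond_expectation_integral : forall A, sigmaZ A ->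
    (\int[P]_(w in A) (f w)%:E = \int[P]_(w in A) (X w)%:E)%E }.

(* A chosen version of E[X | sigma(Z)]; for Z measurable and X integrable one
   exists by Radon-Nikodym and any two agree almost surely. *)
Definition cond_expectation (X : T -> R) : T -> R :=
  xget (cst 0) [set f | is_cond_expectation X f].

Definition cond_covariance (X Y : T -> R) : T -> R :=
  cond_expectation
    ((X \- cond_expectation X) \* (Y \- cond_expectation Y)).

End conditioning.

Definition cumulated_intensity {R : realType} (lambda : R -> R) (s t : R) : R :=
  \int[lebesgue_measure]_(u in `[s, t]) lambda u.

(* Main.v *)
From HB Require Import structures.
Require Import Defs.
From mathcomp Require Import all_boot all_order all_algebra.
From mathcomp Require Import all_classical all_reals all_analysis.
From mathcomp Require Import measurable_realfun ring lra.

Set Implicit Arguments.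
Unset Strict Implicit.
Unset Printing Implicit Defensive.

Import Order.TTheory GRing.Theory Num.Theory.
Import numFieldNormedType.Exports.

Local Open Scope classical_set_scope.
Local Open Scope ring_scope.

(** The argument conditions on the random times.  Write K t = N1 (Lambda t) for
    the counting process, M = Lambda for its mean, and Z = (Y s, Y t).

    For a fixed pair of times, the Poisson process has E[K a] = M a and
    E[K a * K b] = M a * M b + M (min a b) ([poisson_process_mean],
    [poisson_process_mixed]).  Since K and Z are independent, these identities
    survive the substitution of the random times: the joint law of the path of K
    and of Z is a product measure, so Tonelli's theorem integrates out the path
    first, with the times held fixed ([ge0_integral_independent],
    [random_time_mean], [random_time_mixed]).  For that the map
    (w, a) |-> K a w has to be jointly measurable for the sigma-algebra generated
    by K alone; this follows from right-continuity, because K a w < k holds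
    exactly when K q w < k for some rational q > a
    ([measurable_counting_process]).

    Testing against the events of sigma(Z), this says that M (Y s) is a version of
    E[K (Y s) | Z], and that M (Y s) * M (Y t) + M (min (Y s) (Y t)) is a version
    of E[K (Y s) * K (Y t) | Z].  Versions are unique almost surely
    ([is_cond_expectation_ae_eq]), so whichever versions are chosen, the
    conditional covariance has M (min (Y s) (Y t)) as a version, and the law of
    total covariance reduces to linearity of the integral
    ([expectation_cond_covariance], [covariance_cond_expectation],
    [covariance_total]).  The assumed second moments of M (Y s) and M (Y t) make
    every product integrable.

    Finally min (Y s) (Y t) = Y (min s t) almost surely: the inverse of an
    unbounded nondecreasing path is nondecreasing, and the Laplace transform
    forces almost every path of the subordinator to be unbounded
    ([stable_subordinator_unbounded]). *)

(** * Tonelli's theorem for independent random elements *)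

Section independence.
Local Open Scope ereal_scope.
Context d d1 d2 (T : measurableType d) (T1 : measurableType d1)
  (T2 : measurableType d2) (R : realType) (P : probability T R).

(** Independence says that the law of (X, Z) agrees with the product of the two
    laws on rectangles, hence everywhere; Tonelli's theorem does the rest. *)
Lemma ge0_integral_independent (X : {mfun T >-> T1}) (Z : {mfun T >-> T2})
    (f : T1 * T2 -> \bar R) :
  (forall A B, measurable A -> measurable B ->
    P (X @^-1` A `&` Z @^-1` B) = P (X @^-1` A) * P (Z @^-1` B)) ->
  measurable_fun [set: T1 * T2] f -> (forall z, 0 <= f z) ->
  \int[P]_w f (X w, Z w) = \int[P]_w \int[P]_w' f (X w', Z w).
Proof.
move=> XZ mf f0.
have mXZ : measurable_fun setT (fun w => (X w, Z w)) by exact: measurable_fun_pair.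
pose W : {mfun T >-> (T1 * T2)%type} := HB.pack (fun w => (X w, Z w))
  (isMeasurableFun.Build _ _ _ _ _ mXZ).
have joint C : measurable C ->
    (distribution P X \x distribution P Z) C = distribution P W C.
  by move=> mC; apply: product_measure_unique.
transitivity (\int[distribution P W]_z f z).
  by rewrite ge0_integral_distribution.
transitivity (\int[distribution P X \x distribution P Z]_z f z).
  by apply: eq_measure_integral => C mC _; exact/esym/joint.
rewrite fubini_tonelli1// fubini_tonelli//.
rewrite (ge0_integral_distribution _ (f := fun z => _))//.
- apply: eq_integral => w _ /=.
  rewrite (ge0_integral_distribution _ (f := fun y => f (y, Z w)))//.
  exact: measurableT_comp.
- exact: measurable_fun_fubini_tonelli_G.
- by move=> y; apply: integral_ge0.
Qed.

End independence.

(** * Almost sure uniqueness of conditional expectations *)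

Section conditional_expectation.
Context d d' (T : measurableType d) (T' : measurableType d') (R : realType)
  (P : probability T R) (Z : {mfun T >-> T'}).
Local Notation sigmaZ := (preimage_set_system [set: T] Z measurable).

Lemma preimage_system_measurable A : sigmaZ A -> measurable A.
Proof. by move=> [B mB <-]; exact: measurable_funPT. Qed.

Lemma cond_expectationP (X f : T -> R) :
  is_cond_expectation P Z X f ->
  is_cond_expectation P Z X (cond_expectation P Z X).
Proof.
move=> Xf; rewrite /cond_expectation.
have : exists g, [set f | is_cond_expectation P Z X f] g by exists f.
exact: xgetPex.
Qed.

Lemma is_cond_expectation_measurable (X f : T -> R) :
  is_cond_expectation P Z X f -> measurable_fun setT f.
Proof.
by move=> [mf _ _] _ B mB; rewrite setTI; apply: preimage_system_measurable; exact: mf.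
Qed.

(** The event f < g and its complement belong to sigma(Z), so f - g has integral
    zero over each of them; having constant sign there, it vanishes almost
    everywhere. *)
Lemma is_cond_expectation_ae_eq (X f g : T -> R) :
  is_cond_expectation P Z X f -> is_cond_expectation P Z X g ->
  {ae P, forall w, f w = g w}.
Proof.
move=> Xf Xg; have mf := is_cond_expectation_measurable Xf.
have mg := is_cond_expectation_measurable Xg.
have [sf intf Ef] := Xf; have [sg intg Eg] := Xg.
have sfg : sigmaZ [set w | f w < g w].
  have : measurable_fun [set: g_sigma_algebra_preimageType Z]
      (fun w => (f w < g w)).
    apply: measurable_fun_ltr => _ B mB; rewrite setTI.
      exact: sf.
    exact: sg.
  by move=> /(_ measurableT [set true] I); rewrite setTI.
have mA := preimage_system_measurable sfg; set A := [set w | _] in sfg mA.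
have sCA : sigmaZ (~` A).
  have [B mB BA] := sfg; exists (~` B); first exact: measurableC.
  by rewrite -BA !setTI preimage_setC.
have int0 C : sigmaZ C -> (\int[P]_(w in C) ((f w)%:E - (g w)%:E) = 0)%E.
  move=> sC; have mC := preimage_system_measurable sC.
  rewrite integralB_EFin//; [|exact: integrableS intf|exact: integrableS intg].
  rewrite Ef// Eg// subee// -Ef//; apply: integrable_fin_num => //.
  exact: integrableS intf.
have mfg : measurable_fun setT (fun w => (f w)%:E - (g w)%:E)%E.
  by apply: emeasurable_funB; exact/measurable_EFinP.
have : (\int[P]_w `|(f w)%:E - (g w)%:E| = 0)%E.
  rewrite -(setUv A) ge0_integral_setU//; last 3 first.
  - exact: measurableC.
  - by rewrite setUv; apply: measurableT_comp.
  - exact/disj_setPCl.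
  rewrite [X in (X + _)%E](_ : _ = 0%E) ?add0e.
    rewrite -[RHS](int0 _ sCA); apply: eq_integral => w; rewrite inE/= => /negP.
    by rewrite -leNgt => gf; rewrite ?ger0_norm ?subr_ge0.
  transitivity (\int[P]_(w in A) - ((f w)%:E - (g w)%:E))%E.
    apply: eq_integral => w; rewrite inE/= => fg.
    by rewrite ?ltr0_norm ?subr_lt0.
  rewrite integralN ?int0 ?oppe0//; apply: integrable_add_def => //.
  apply: integrableB => //; [exact: integrableS intf|exact: integrableS intg].
move=> /ae_eq_integral_abs -/(_ measurableT mfg).
apply: filterS => w /(_ I) /=; rewrite -EFinB => -[] /eqP.
by rewrite subr_eq0 => /eqP.
Qed.

End conditional_expectation.

(** * Moments of the Poisson process *)

Section integer_valued.
Local Open Scope ereal_scope.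
Context d (T : measurableType d) (R : realType) (P : probability T R).

Lemma measurable_fun_natr (X : T -> nat) :
  measurable_fun setT X -> measurable_fun setT (fun w => (X w)%:R : R).
Proof.
have mnatr : measurable_fun [set: nat] (fun k => k%:R : R) by [].
exact: measurableT_comp.
Qed.

Lemma ge0_integral_nat_valued (X : {mfun T >-> nat}) (f : nat -> \bar R) :
  (forall k, 0 <= f k) ->
  \int[P]_w f (X w) = \sum_(k <oo) f k * P [set w | X w = k].
Proof.
move=> f0.
have mX k : measurable (X @^-1` [set k]) by exact: measurable_funPTI.
have <- : \bigcup_k (X @^-1` [set k]) = setT.
  by rewrite -subTset => w _; exists (X w).
rewrite ge0_integral_bigcup//; first last.
- exact: trivIset_preimage1.
- exact/measurable_funTS/measurableT_comp.
apply: eq_eseriesr => k _; rewrite -(integral_cst _ (mX k)).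
by apply: eq_integral => w; rewrite inE /= => ->.
Qed.

End integer_valued.

Section poisson_moments.
Local Open Scope ereal_scope.
Context d (T : measurableType d) (R : realType) (P : probability T R).

Lemma poisson_pmfS (r : R) k : (0 < r)%R ->
  (k.+1%:R * poisson_pmf r k.+1 = r * poisson_pmf r k)%R.
Proof.
move=> r0; rewrite /poisson_pmf r0 factS natrM exprS.
have := fact_gt0 k; rewrite -(ltr_nat R) => k0.
have : (0 < k.+1%:R :> R)%R by rewrite ltr0n.
by move=> kk; field; rewrite !gt_eqF.
Qed.

(** The Stein-Chen identity E[X f(X)] = r E[f(X + 1)], a shift of the summation
    index under [poisson_pmfS].  It yields all moments without summing a series:
    f = 1 gives the mean and f(k) = k the second moment. *)
Lemma poisson_size_bias (X : {mfun T >-> nat}) (r : R) (f : nat -> \bar R) :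
  (0 < r)%R -> (forall k, P [set w | X w = k] = (poisson_pmf r k)%:E) ->
  (forall k, 0 <= f k) ->
  \int[P]_w ((X w)%:R%:E * f (X w)) = r%:E * \int[P]_w f (X w).+1.
Proof.
move=> r0 lawX f0.
rewrite (@ge0_integral_nat_valued _ _ _ P X (fun k => k%:R%:E * f k)); last first.
  by move=> k; rewrite mule_ge0// lee_fin.
rewrite (@ge0_integral_nat_valued _ _ _ P X (fun k => f k.+1))//.
rewrite -nneseriesZl; last by move=> k _; rewrite mule_ge0.
rewrite nneseries_recl//; last by move=> k _; rewrite !mule_ge0// lee_fin.
rewrite !mul0e add0e -(nneseries_addn 1)/=; last first.
  by move=> k; rewrite !mule_ge0// lee_fin.
apply: eq_eseriesr => k _; rewrite addn1 !lawX.
rewrite muleC muleA -EFinM mulrC poisson_pmfS// EFinM.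
by rewrite -muleA; congr *%E; rewrite muleC.
Qed.

Lemma poisson_mean (X : {mfun T >-> nat}) (r : R) : (0 < r)%R ->
  (forall k, P [set w | X w = k] = (poisson_pmf r k)%:E) ->
  \int[P]_w ((X w)%:R)%:E = r%:E.
Proof.
move=> r0 lawX.
have := @poisson_size_bias X r (cst 1) r0 lawX (fun _ => lee01).
rewrite /= integral_cst//= probability_setT !mule1 => <-.
by apply: eq_integral => w _; rewrite mule1.
Qed.

Lemma poisson_second_moment (X : {mfun T >-> nat}) (r : R) : (0 < r)%R ->
  (forall k, P [set w | X w = k] = (poisson_pmf r k)%:E) ->
  \int[P]_w ((X w)%:R * (X w)%:R)%:E = (r * r + r)%:E.
Proof.
move=> r0 lawX.
under eq_integral do rewrite EFinM.
rewrite (@poisson_size_bias X r (fun k => k%:R%:E) r0 lawX); last first.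
  by move=> k; rewrite lee_fin.
under eq_integral do rewrite -natr1 EFinD.
rewrite ge0_integralD//.
- by rewrite (poisson_mean r0 lawX) integral_cst//= probability_setT mule1 -EFinD
     -EFinM mulrDr mulr1.
- exact/measurable_EFinP/measurable_fun_natr.
Qed.

End poisson_moments.

Section poisson_process.
Local Open Scope ereal_scope.
Context d (T : measurableType d) (R : realType) (P : probability T R).
Variables (N : R -> {RV P >-> nat}) (N_poisson : unit_poisson_process N).

Lemma poisson_process0 w : N 0%R w = 0%N.
Proof.
by have /(path_start0)/eqP := poisson_paths N_poisson w; rewrite pnatr_eq0 => /eqP.
Qed.

Lemma poisson_process_le s t w : (0 <= s)%R -> (s <= t)%R -> (N s w <= N t w)%N.
Proof.
move=> s0 st; rewrite -(ler_nat R).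
exact: (path_nondecreasing (poisson_paths N_poisson w)).
Qed.

Lemma poisson_process_law t k : (0 < t)%R ->
  P [set w | N t w = k] = (poisson_pmf t k)%:E.
Proof.
move=> t0; rewrite -[in RHS](subr0 t) -(poisson_increment_law N_poisson)//.
by congr (P _); apply/seteqP; split=> w /=; rewrite poisson_process0.
Qed.

Lemma poisson_process_mean t : (0 <= t)%R -> \int[P]_w ((N t w)%:R)%:E = t%:E.
Proof.
rewrite le_eqVlt => /orP[/eqP<-|t0].
  by rewrite integral0_eq// => w _; rewrite poisson_process0.
by apply: poisson_mean => // k; exact: poisson_process_law.
Qed.

Section increment.
Variables s t : R.
Hypotheses (s0 : (0 <= s)%R) (st : (s <= t)%R).

Let D w := (N t w - N s w)%N.
Let mD : measurable_fun setT D. Proof. exact: measurable_fun_subn. Qed.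
Let X : {mfun T >-> nat} := HB.pack D (isMeasurableFun.Build _ _ _ _ _ mD).

(** Two consecutive increments, over [0, s] and [s, t], of the independent
    increments property; the first one is N s because paths start at 0. *)
Lemma poisson_increment_indep A B :
  P (N s @^-1` A `&` X @^-1` B) = P (N s @^-1` A) * P (X @^-1` B).
Proof.
pose u i : R := if i is j.+1 then if j is _.+1 then t else s else 0%R.
pose C i : set R := [set x%:R | x in if i is 0%N then A else B].
have mC i : measurable (C i).
  apply: countable_measurable => //.
  by apply: sub_countable (card_image_le _ _) _; exact: countableP.
have CE i n : C i n%:R = (if i is 0%N then A else B) n.
  apply/propext; split=> [[m mA /eqP]|nA]; last by exists n.
  by rewrite eqr_nat => /eqP <-.
have u0 i : (0 <= u i)%R by case: i => [|[|i]]//=; exact: le_trans st.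
have uS i : (u i <= u i.+1)%R by case: i => [|[|i]]//=.
have := poisson_independent_increments N_poisson 2%N u0 uS mC.
rewrite big_ord_recl big_ord1 /= => indep.
(* The sequence of times u is 0, s, t, t, ... *)
transitivity (P (\bigcap_(i < 2%N)
  [set w | C i ((N (u i.+1) w)%:R - (N (u i) w)%:R)%R])).
  congr (P _); apply/seteqP; split=> w /=.
    move=> [Aw Bw] [|[|//]] _ /=.
      by rewrite poisson_process0 subr0 CE.
    by rewrite -natrB ?poisson_process_le// CE.
  move=> H; split; [have := H 0%N isT|have := H 1%N isT].
    by rewrite /= poisson_process0 subr0 CE.
  by rewrite /= -natrB ?poisson_process_le// CE.
rewrite indep; congr (P _ * P _); apply/seteqP; split=> w /=.
- by rewrite poisson_process0 subr0 CE.
- by rewrite poisson_process0 subr0 CE.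
- by rewrite -natrB ?poisson_process_le// CE.
- by rewrite -natrB ?poisson_process_le// CE.
Qed.

(** Splitting N t = N s + (N t - N s), the square contributes s ^ 2 + s and the
    independent increment contributes s * (t - s). *)
Lemma poisson_process_mixed_le :
  \int[P]_w ((N s w)%:R * (N t w)%:R)%:E = (s * t + s)%:E.
Proof.
move: s0; rewrite le_eqVlt => /orP[/eqP<-|s_gt0].
  by rewrite integral0_eq ?mul0r ?addr0// => w _; rewrite poisson_process0 mul0r.
have NsE := poisson_second_moment s_gt0 (fun k => poisson_process_law k s_gt0).
move: st; rewrite le_eqVlt => /orP[/eqP <-//|s_lt_t].
have lawX k : P [set w | X w = k] = (poisson_pmf (t - s) k)%:E.
  rewrite -(poisson_increment_law N_poisson)//; congr (P _).
  apply/seteqP; split=> w /= => [<-|Nst].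
    by rewrite subnKC// poisson_process_le.
  by rewrite /D Nst addKn.
have meanX : \int[P]_w ((X w)%:R)%:E = (t - s)%:E.
  by apply: poisson_mean => //; rewrite subr_gt0.
have crossE : \int[P]_w ((N s w)%:R * (X w)%:R)%:E = (s * (t - s))%:E.
  rewrite (ge0_integral_independent (X := N s) (Z := X)
    (f := fun z => (z.1%:R * z.2%:R)%:E))//.
  - under eq_integral => w _.
      under eq_integral => v _ do rewrite /= EFinM muleC.
      rewrite ge0_integralZl//; last first.
        exact/measurable_EFinP/measurable_fun_natr.
      rewrite (poisson_process_mean s0) muleC.
      over.
    rewrite ge0_integralZl//.
    + by rewrite meanX.
    + exact/measurable_EFinP/measurable_fun_natr.
  - by move=> *; exact: poisson_increment_indep.
  - apply/measurable_EFinP; apply: measurable_funM.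
    + exact: measurable_fun_natr measurable_fst.
    + exact: measurable_fun_natr measurable_snd.
transitivity (\int[P]_w (((N s w)%:R * (N s w)%:R)%:E
    + ((N s w)%:R * (X w)%:R)%:E)).
  apply: eq_integral => w _; rewrite -EFinD -mulrDr -natrD.
  by rewrite subnKC// poisson_process_le.
rewrite ge0_integralD//.
- by rewrite NsE crossE -EFinD; congr EFin; ring.
- apply/measurable_EFinP; apply: measurable_funM;
    exact: measurable_fun_natr.
- apply/measurable_EFinP; apply: measurable_funM;
    exact: measurable_fun_natr.
Qed.

End increment.

Lemma poisson_process_mixed a b : (0 <= a)%R -> (0 <= b)%R ->
  \int[P]_w ((N a w)%:R * (N b w)%:R)%:E = (a * b + Num.min a b)%:E.
Proof.
move=> a0 b0; have [ab|/ltW ba] := leP a b.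
  exact: poisson_process_mixed_le.
under eq_integral do rewrite mulrC.
by rewrite poisson_process_mixed_le// mulrC.
Qed.

End poisson_process.

(** * First passage times of the stable subordinator *)

Section first_passage.
Context d (T : measurableType d) (R : realType).
Implicit Types (L : R -> T -> R) (t : R) (w : T).

Lemma first_passage_le L s t w : s <= t -> (exists u, 0 <= u /\ t < L u w) ->
  first_passage L s w <= first_passage L t w.
Proof.
move=> st [v [v0 tv]]; apply: lb_le_inf; first by exists v.
move=> u [u0 tu]; apply: ge_inf; first by exists 0 => ? [].
by split => //; exact: le_lt_trans tu.
Qed.

(** The second alternative is the event that the path never exceeds t, on which
    the infimum of the empty set is 0. *)
Lemma first_passage_ltP L t w a : (forall u v, 0 <= u -> u <= v -> L u w <= L v w) ->
  first_passage L t w < a <->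
  (exists q : rat, [/\ 0 <= ratr q :> R, ratr q < a & t < L (ratr q) w]) \/
  (0 < a /\ forall n : nat, L n%:R w <= t).
Proof.
move=> L_nd; split; last first.
  move=> [[q [q0 qa tq]]|[a0 Lt]].
    by apply: le_lt_trans qa; apply: ge_inf => //; exists 0 => ? [].
  rewrite /first_passage (_ : [set u | _] = set0) ?inf0// -subset0 => u [/= u0].
  apply/negP; rewrite -leNgt (le_trans _ (Lt (Num.truncn u).+1))//.
  by apply: L_nd => //; rewrite ltW// truncnS_gt.
have [S0|/set0P S0] := eqVneq [set u | 0 <= u /\ t < L u w] set0.
  rewrite /first_passage S0 inf0 => a0; right; split=> // n.
  rewrite leNgt; apply/negP => tn.
  by have : set0 (n%:R : R) by rewrite -S0.
move=> /(inf_lt S0)[u [u0 tu] ua]; left.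
have [q] := rat_in_itvoo ua; rewrite in_itv/= => /andP[uq qa].
exists q; split => //; first by rewrite (le_trans u0)// ltW.
by apply: lt_le_trans tu _; apply: L_nd => //; exact: ltW.
Qed.

Lemma measurable_first_passage L t :
  (forall w u v, 0 <= u -> u <= v -> L u w <= L v w) ->
  (forall u, measurable_fun setT (L u)) ->
  measurable_fun setT (first_passage L t).
Proof.
move=> L_nd mL; apply: (measurability (@RGenInftyO.G R)).
  exact: RGenInftyO.measurableE.
move=> _ [_ [a ->] <-]; rewrite setTI.
have mgt u : measurable [set w | t < L u w].
  rewrite [X in measurable X](_ : _ = L u @^-1` `]t, +oo[).
    by rewrite -[X in measurable X]setTI; exact: mL.
  by apply/seteqP; split=> w /=; rewrite in_itv/= andbT.
rewrite [X in measurable X](_ : _ =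
  (\bigcup_(q : rat) ([set w | t < L (ratr q) w] `&`
                      [set w | 0 <= ratr q :> R /\ ratr q < a])) `|`
  ([set w | 0 < a] `&` ~` \bigcup_(n : nat) [set w | t < L n%:R w])).
  apply: measurableU.
    apply: bigcupT_measurable_rat => q; apply: measurableI => //.
    have [h|h] := pselect (0 <= ratr q :> R /\ ratr q < a).
      by rewrite [X in measurable X](_ : _ = setT)//; apply/seteqP; split.
    by rewrite [X in measurable X](_ : _ = set0)//; apply/seteqP; split.
  apply: measurableI.
    have [h|h] := boolP (0 < a).
      by rewrite [X in measurable X](_ : _ = setT)//; apply/seteqP; split.
    by rewrite [X in measurable X](_ : _ = set0)//; apply/seteqP; split => //=.
  by apply: measurableC; exact: bigcup_measurable.
apply/seteqP; split=> w; rewrite /= in_itv/=.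
  move=> /(first_passage_ltP _ _ (L_nd w))[[q [q0 qa tq]]|[a0 Lt]].
    by left; exists q.
  by right; split => // -[n _ /=]; rewrite ltNge Lt.
move=> H; apply/(first_passage_ltP _ _ (L_nd w)); case: H.
  by move=> [q _ [/= tq [q0 qa]]]; left; exists q.
move=> [a0 H]; right; split => // n; rewrite leNgt; apply/negP => tn.
by apply: H; exists n.
Qed.

(** Chernoff's bound at parameter 1: P (L n <= t) <= exp t * E[exp (- L n)] =
    exp (t - n), which tends to 0, whereas a path bounded by t lies in all the
    events L n <= t. *)
Lemma stable_subordinator_unbounded (P : probability T R) alpha
    (L : R -> {RV P >-> R}) (t : R) : stable_subordinator alpha L -> 0 <= t ->
  {ae P, forall w, exists u, 0 <= u /\ t < L u w}.
Proof.
move=> L_stable t0; pose E n := [set w | L n%:R w <= t].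
have mE n : measurable (E n).
  rewrite [X in measurable X](_ : _ = L n%:R @^-1` `]-oo, t]).
    exact: measurable_funPTI.
  by apply/seteqP; split=> w /=; rewrite in_itv.
have PE n : (P (E n) <= (expR (t - n%:R))%:E)%E.
  have := subordinator_laplace L_stable (ler01) (ler0n R n).
  rewrite powR1 mulr1 unlock => laplace.
  have : ((expR (- t))%:E * P (E n) <= (expR (- n%:R))%:E)%E.
    rewrite -laplace -integral_cst//.
    have mf : measurable_fun setT (fun w => (expR (- (1 * L n%:R w)))%:E).
      apply/measurable_EFinP; apply: measurableT_comp => //.
      by apply: measurableT_comp => //; exact: measurable_funM.
    apply: (@le_trans _ _ (\int[P]_(w in E n) (expR (- (1 * L n%:R w)))%:E)%E).
      apply: ge0_le_integral => //.
      - by move=> w _; rewrite lee_fin expR_ge0.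
      - exact: measurable_funTS.
      - by move=> w Ew; rewrite lee_fin ler_expR lerN2 mul1r.
    by apply: ge0_subset_integral => // w _; rewrite lee_fin expR_ge0.
  rewrite -(@lee_pmul2l _ (expR t)%:E)//=; last by rewrite lte_fin expR_gt0.
  by rewrite muleA -!EFinM -!expRD subrr expR0 mul1e.
exists (\bigcap_n E n); split.
- exact: bigcap_measurable.
- apply/eqP; rewrite eq_le measure_ge0 andbT; apply/lee_addgt0Pr => e e0.
  rewrite add0e.
  (* Any integer n >= t - ln e works. *)
  have [n tn] : exists n : nat, expR (t - n%:R) <= e.
    exists (Num.truncn (t - ln e)).+1; rewrite -ler_ln ?posrE ?expR_gt0// expRK.
    by rewrite lerBlDr -lerBlDl ltW// truncnS_gt.
  rewrite (@le_trans _ _ (P (E n)))// ?(le_trans (PE n))// le_measure ?inE//.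
    exact: bigcap_measurable.
  exact: bigcap_inf.
- move=> w /= bounded n _; rewrite /E/= leNgt; apply/negP => tn.
  by apply: bounded; exists n%:R.
Qed.

End first_passage.

(** * Time-changed counting paths *)

Section cadlag_paths.
Context (R : realType).

Lemma increasing_cadlag_ge0 (x : R -> R) t :
  increasing_cadlag_from0 x -> 0 <= t -> 0 <= x t.
Proof. by move=> hx t0; rewrite -(path_start0 hx) (path_nondecreasing hx). Qed.

(** Right-continuity composes because y u tends to y t from above, possibly
    staying equal to y t. *)
Lemma increasing_cadlag_comp (x y : R -> R) :
  increasing_cadlag_from0 x -> increasing_cadlag_from0 y ->
  increasing_cadlag_from0 (x \o y).
Proof.
move=> hx hy; split=> [|s t s0 st|t t0] /=.
- by rewrite (path_start0 hy) (path_start0 hx).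
- apply: (path_nondecreasing hx); first exact: increasing_cadlag_ge0.
  exact: (path_nondecreasing hy).
- have yt0 := increasing_cadlag_ge0 hy t0.
  have xc := cvg_at_right_within (path_right_continuous hx yt0).
  apply: (cvg_comp _ _ _ xc) => A /= [e /= e0 eA].
  have := path_right_continuous hy t0.
  move=> /cvgrPdist_lt/(_ _ e0) ye; near=> u.
  apply: eA => /=; last first.
    by apply: (path_nondecreasing hy) => //; near: u; exact: nbhs_right_ge.
  by near: u.
Unshelve. all: by end_near. Qed.

(** Right-continuity of an integer-valued path makes it constant just after a,
    which reduces its value at an arbitrary time to values at rational times. *)
Lemma counting_path_ltP (n : R -> nat) (k : nat) (a : R) :
  increasing_cadlag_from0 (fun t => (n t)%:R) -> 0 <= a ->
  (n a < k)%N <->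
  exists q : rat, [/\ 0 <= ratr q :> R, a < ratr q & (n (ratr q) < k)%N].
Proof.
move=> hn a0; split; last first.
  move=> [q [q0 aq]]; apply: leq_ltn_trans.
  by rewrite -(ler_nat R); apply: (path_nondecreasing hn) => //; exact: ltW.
move=> nak; have := path_right_continuous hn a0.
move=> /cvgrPdist_lt/(_ _ ltr01)[e /= e0 ne].
have [q] : exists q : rat, ratr q \in `]a, (a + e)[.
  by apply: rat_in_itvoo; rewrite ltrDl.
rewrite in_itv/= => /andP[aq qae].
have := ne (ratr q); rewrite /= ltr0_norm ?subr_lt0// opprB ltrBlDl => /(_ qae aq).
have naq : (n a <= n (ratr q))%N.
  by rewrite -(ler_nat R); apply: (path_nondecreasing hn) => //; exact: ltW.
rewrite distrC -natrB// ger0_norm// ltrn1 ltnS leqn0 subn_eq0 => nqa.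
by exists q; split => //; [rewrite (le_trans a0)// ltW|exact: leq_ltn_trans nak].
Qed.

(** By [counting_path_ltP], the set where K a w < k is a countable union of
    rectangles. *)
Lemma measurable_counting_process d (T : measurableType d) (K : R -> T -> nat) :
  (forall t, 0 <= t -> measurable_fun setT (K t)) ->
  (forall w, increasing_cadlag_from0 (fun t => (K t w)%:R : R)) ->
  (forall t w, t <= 0 -> K t w = 0%N) ->
  measurable_fun [set: T * R] (fun z => K z.2 z.1).
Proof.
move=> mK hK K0.
have mlt k : measurable [set z : T * R | (K z.2 z.1 < k)%N].
  rewrite [X in measurable X](_ : _ = \bigcup_(q : rat)
    ([set w | 0 <= ratr q :> R /\ (K (ratr q) w < k)%N] `*` `]-oo, ratr q[)).
    apply: bigcupT_measurable_rat => q; apply: measurableX => //.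
    have [q0|q0] := boolP (0 <= ratr q :> R).
      rewrite [X in measurable X](_ : _ = K (ratr q) @^-1` [set j | (j < k)%N]).
        by rewrite -[X in measurable X]setTI; exact: mK.
      by apply/seteqP; split=> w //= [].
    by rewrite [X in measurable X](_ : _ = set0)//; apply/seteqP; split=> w // [].
  apply/seteqP; split=> -[w a] /=.
    move=> Kk; have [a0|a0] := leP 0 a.
      have /(counting_path_ltP _ (hK w) a0)[q [q0 aq Kq]] := Kk.
      by exists q => //; split => //=; rewrite in_itv.
    (* For a < 0 the count is 0, and q = 0 is a rational time after a. *)
    exists 0%Q => //; split => /=; last by rewrite in_itv/= raddf0.
    by rewrite raddf0 K0//; rewrite K0// ltW in Kk.
  move=> [q _ [/= [q0 Kq]]]; rewrite in_itv/= => aq.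
  have [a0|a0] := leP 0 a; first by apply/(counting_path_ltP _ (hK w) a0); exists q.
  by rewrite K0 ?ltW//; apply: leq_ltn_trans Kq.
move=> _ B _; rewrite setTI.
rewrite [X in measurable X](_ : _ = \bigcup_(k in B)
   ([set z : T * R | (K z.2 z.1 < k.+1)%N] `\` [set z | (K z.2 z.1 < k)%N])).
  by apply: bigcup_measurable => k _; exact: measurableD.
apply/seteqP; split=> z /=.
  by move=> BK; exists (K z.2 z.1) => //; split => /=; rewrite ?ltnS// ltnn.
move=> [k Bk [/=]]; rewrite ltnS => Kk /negP; rewrite -leqNgt => kK.
by rewrite (_ : K z.2 z.1 = k)//; apply/eqP; rewrite eqn_leq Kk.
Qed.

End cadlag_paths.

(** * The cumulated intensity *)

Section cumulated_intensity.
Context (R : realType) (lambda : R -> R).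
Hypothesis lambda_ge0 : forall u : R, 0 <= u -> 0 <= lambda u.
Hypothesis lambda_integrable : forall s t : R, 0 <= s -> s <= t ->
  lebesgue_measure.-integrable `[s, t] (EFin \o lambda).

Local Notation Lambda := (cumulated_intensity lambda 0).

(** The interval [0, t] is empty for t < 0, so Lambda extends to a nondecreasing
    function on the whole line. *)
Lemma cumulated_intensity_le0 t : t <= 0 -> Lambda t = 0.
Proof.
rewrite /cumulated_intensity le_eqVlt => /orP[/eqP->|t0].
  by rewrite set_itv1 Rintegral_set1.
by rewrite set_itv_ge ?Rintegral_set0// bnd_simp -ltNge.
Qed.

Lemma cumulated_intensity_ge0 t : 0 <= Lambda t.
Proof. by apply: Rintegral_ge0 => u; rewrite /= in_itv/= => /andP[/lambda_ge0]. Qed.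

Lemma cumulated_intensity_nondecreasing : nondecreasing_fun Lambda.
Proof.
move=> s t st; have [s0|/ltW s0] := leP 0 s; last first.
  by rewrite cumulated_intensity_le0// cumulated_intensity_ge0.
have t0 := le_trans s0 st.
apply: fine_le.
- by apply: integrable_fin_num => //; exact: lambda_integrable.
- by apply: integrable_fin_num => //; exact: lambda_integrable.
- apply: ge0_subset_integral => //.
  + by have /integrableP[] := lambda_integrable (lexx 0) t0.
  + by move=> u; rewrite /= in_itv/= lee_fin => /andP[/lambda_ge0].
  + by apply: subset_itvl; rewrite bnd_simp.
Qed.

Lemma measurable_cumulated_intensity : measurable_fun setT Lambda.
Proof. exact: nondecreasing_measurable cumulated_intensity_nondecreasing. Qed.

Lemma cumulated_intensity_path : increasing_cadlag_from0 Lambda.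
Proof.
split=> [|s t _|t t0].
- exact: cumulated_intensity_le0.
- exact: cumulated_intensity_nondecreasing.
- have t1 : 0 < t + 1 by rewrite ltr_wpDl.
  have := parameterized_integral_continuous (ltW t1)
    (lambda_integrable (lexx 0) (ltW t1)).
  move=> /(continuous_within_itvP _ t1)[int_cont right0 _].
  move: t0; rewrite le_eqVlt => /orP[/eqP<-//|t0].
  by apply: cvg_at_right_filter; apply: int_cont; rewrite in_itv/= t0 ltrDl/=.
Qed.

End cumulated_intensity.

(** * The law of total covariance *)

Section covariance_decomposition.
Local Open Scope ereal_scope.
Context d d' (T : measurableType d) (T' : measurableType d') (R : realType)
  (P : probability T R) (Z : {mfun T >-> T'}).
Variables X Y U V W : T -> R.
Hypotheses (mX : measurable_fun setT X) (mY : measurable_fun setT Y)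
  (iX : P.-integrable setT (EFin \o X)) (iY : P.-integrable setT (EFin \o Y))
  (iXY : P.-integrable setT (EFin \o (X \* Y)%R))
  (iXV : P.-integrable setT (EFin \o (X \* V)%R))
  (iUY : P.-integrable setT (EFin \o (U \* Y)%R))
  (iUV : P.-integrable setT (EFin \o (U \* V)%R)).
Hypotheses (XU : is_cond_expectation P Z X U) (YV : is_cond_expectation P Z Y V)
  (XV_UV : is_cond_expectation P Z (X \* V)%R (U \* V)%R)
  (UY_UV : is_cond_expectation P Z (U \* Y)%R (U \* V)%R).
Hypotheses (sW : forall B : set R, measurable B ->
    preimage_set_system [set: T] Z measurable (W @^-1` B))
  (iW : P.-integrable setT (EFin \o W))
  (XY_UVW : forall A, preimage_set_system [set: T] Z measurable A ->
    \int[P]_(w in A) (X w * Y w)%:E = \int[P]_(w in A) (U w * V w + W w)%:E).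

Local Notation CX := (cond_expectation P Z X).
Local Notation CY := (cond_expectation P Z Y).

Let mU : measurable_fun setT U := is_cond_expectation_measurable XU.
Let mV : measurable_fun setT V := is_cond_expectation_measurable YV.
Let XCX : is_cond_expectation P Z X CX := cond_expectationP XU.
Let YCY : is_cond_expectation P Z Y CY := cond_expectationP YV.
Let mCX : measurable_fun setT CX := is_cond_expectation_measurable XCX.
Let mCY : measurable_fun setT CY := is_cond_expectation_measurable YCY.

Let sigmaT : preimage_set_system [set: T] Z measurable setT.
Proof. by exists setT => //; rewrite preimage_setT setTI. Qed.

(** Almost surely (X - CX) * (Y - CY) = (XY - XV) - (UY - UV).  Over an event of
    sigma(Z), each of the last three products has the integral of UV and XY that
    of UV + W, which leaves the integral of W. *)
Lemma cond_covariance_version :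
  is_cond_expectation P Z ((X \- CX) \* (Y \- CY))%R W.
Proof.
split => // A sA; have mA := preimage_system_measurable sA.
have iA (f : T -> R) : P.-integrable setT (EFin \o f) -> P.-integrable A (EFin \o f).
  exact: integrableS.
transitivity (\int[P]_(w in A)
  ((X w * Y w - X w * V w)%:E - (U w * Y w - U w * V w)%:E)).
  rewrite integralB_EFin//; last 2 first.
  - have := integrableB mA (iA _ iXY) (iA _ iXV); exact: eq_integrable.
  - have := integrableB mA (iA _ iUY) (iA _ iUV); exact: eq_integrable.
  have split2 (f g : T -> R) : P.-integrable setT (EFin \o f) ->
      P.-integrable setT (EFin \o g) ->
      \int[P]_(w in A) (f w - g w)%:E =
      \int[P]_(w in A) (f w)%:E - \int[P]_(w in A) (g w)%:E.
    by move=> /iA fi /iA gi; rewrite -integralB_EFin.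
  rewrite (split2 (X \* Y)%R (X \* V)%R)// (split2 (U \* Y)%R (U \* V)%R)//.
  rewrite XY_UVW// -(cond_expectation_integral XV_UV)//.
  rewrite -(cond_expectation_integral UY_UV)//= integralD_EFin//;
    [|exact: iA iUV|exact: iA].
  have : \int[P]_(w in A) (U w * V w)%:E \is a fin_num.
    by apply: integrable_fin_num => //; exact: iA iUV.
  have : \int[P]_(w in A) (W w)%:E \is a fin_num.
    by apply: integrable_fin_num => //; exact: iA iW.
  move=> /fineK <- /fineK <-; rewrite -?EFinD -?EFinB; congr EFin.
  by rewrite subrr subr0 addrAC subrr add0r.
apply: ae_eq_integral => //.
- apply/measurable_EFinP/measurable_funTS; apply: measurable_funB;
    by apply: measurable_funB; exact: measurable_funM.
- apply/measurable_EFinP/measurable_funTS; apply: measurable_funM;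
    exact: measurable_funB.
have := is_cond_expectation_ae_eq XU XCX.
have := is_cond_expectation_ae_eq YV YCY.
apply: filterS2 => w VE UE _; rewrite /= -UE -VE; congr EFin; ring.
Qed.

Lemma expectation_cond_covariance : 'E_P[cond_covariance P Z X Y] = 'E_P[W].
Proof.
have ccW := cond_covariance_version.
have cc := cond_expectationP ccW.
by rewrite unlock (cond_expectation_integral cc)// (cond_expectation_integral ccW).
Qed.

Lemma covariance_cond_expectation : covariance P CX CY = covariance P U V.
Proof.
have EX : 'E_P[CX] = 'E_P[U].
  by rewrite unlock (cond_expectation_integral XCX)// (cond_expectation_integral XU).
have EY : 'E_P[CY] = 'E_P[V].
  by rewrite unlock (cond_expectation_integral YCY)// (cond_expectation_integral YV).
rewrite unlock EX EY unlock; apply: ae_eq_integral => //.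
- by apply/measurable_EFinP; apply: measurable_funM; exact: measurable_funB.
- by apply/measurable_EFinP; apply: measurable_funM; exact: measurable_funB.
have := is_cond_expectation_ae_eq XU XCX.
have := is_cond_expectation_ae_eq YV YCY.
by apply: filterS2 => w VE UE _; rewrite /= /GRing.mul/= UE VE.
Qed.

Lemma covariance_total : covariance P X Y = 'E_P[W] + covariance P U V.
Proof.
have iU := cond_expectation_integrable XU.
have iV := cond_expectation_integrable YV.
rewrite !covarianceE; try exact/Lfun1_integrable.
have EX : 'E_P[X] = 'E_P[U] by rewrite unlock (cond_expectation_integral XU).
have EY : 'E_P[Y] = 'E_P[V] by rewrite unlock (cond_expectation_integral YV).
have EXY : 'E_P[X * Y] = 'E_P[U * V] + 'E_P[W].
  by rewrite unlock XY_UVW// integralD_EFin.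
by rewrite EX EY EXY addeAC addeC.
Qed.

End covariance_decomposition.

(** * A counting process at independent random times *)

Section random_times.
Local Open Scope ereal_scope.
Context d d' (T : measurableType d) (T' : measurableType d') (R : realType)
  (P : probability T R) (Z : {mfun T >-> T'}) (K : R -> T -> nat) (M : R -> R).
Hypotheses (mK : forall t, (0 <= t)%R -> measurable_fun setT (K t))
  (K_paths : forall w, increasing_cadlag_from0 (fun t => (K t w)%:R : R))
  (K0 : forall t w, (t <= 0)%R -> K t w = 0%N)
  (K_Z_independent : forall A C, process_sigma K A -> measurable C ->
     P (A `&` Z @^-1` C) = P A * P (Z @^-1` C)).
Hypotheses (M0 : forall t, (0 <= M t)%R) (mM : measurable_fun setT M)
  (K_mean : forall a, \int[P]_w ((K a w)%:R)%:E = (M a)%:E)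
  (K_mixed : forall a b, \int[P]_w ((K a w)%:R * (K b w)%:R)%:E =
     (M a * M b + M (Num.min a b))%:E).

(** The path of K is represented by the point w itself, seen in T with the
    sigma-algebra generated by K. *)
Let G : set (set T) :=
  \bigcup_(t in [set t : R | (0 <= t)%R]) preimage_set_system setT (K t) measurable.
Local Notation TK := (g_sigma_algebraType G).

Let past : T -> TK := id.
Let mpast : measurable_fun setT past.
Proof.
have GT : <<s G >> `<=` @measurable _ T.
  apply: smallest_sub; first exact: sigma_algebra_measurable.
  by move=> A [t t0 [B mB <-]]; exact: mK.
by move=> _ B mB; rewrite setTI; exact: GT.
Qed.
Let pastRV : {mfun T >-> TK} := HB.pack past (isMeasurableFun.Build _ _ _ _ _ mpast).

Let mKjoint : measurable_fun [set: TK * R] (fun z => K z.2 z.1).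
Proof.
apply: (@measurable_counting_process R _ TK) => // t t0 _ B mB.
by apply: sub_sigma_algebra; exists t => //; exists B.
Qed.

Let mKt a : measurable_fun setT (fun w => (K a w)%:R : R).
Proof.
apply: measurable_fun_natr; have [a0|/ltW a0] := leP 0%R a; first exact: mK.
by rewrite (_ : K a = cst 0%N)//; apply/funext => w; rewrite K0.
Qed.

Let mKtime (g : T' -> R) : measurable_fun setT g ->
  measurable_fun [set: TK * T'] (fun z => (K (g z.2) z.1)%:R : R).
Proof.
move=> mg; apply: measurable_fun_natr.
have mtime : measurable_fun [set: TK * T'] (fun z => (z.1, g z.2)).
  by apply: measurable_fun_pair => //; exact: measurableT_comp.
exact: (measurableT_comp mKjoint mtime).
Qed.

Lemma measurable_random_time (g : T' -> R) : measurable_fun setT g ->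
  measurable_fun setT (fun w => (K (g (Z w)) w)%:R : R).
Proof.
move=> mg.
have mpair : measurable_fun setT (fun w => (past w, Z w)) by exact: measurable_fun_pair.
exact: (measurableT_comp (mKtime mg) mpair).
Qed.

Lemma integral_random_time (f : TK * T' -> \bar R) :
  measurable_fun [set: TK * T'] f -> (forall z, 0 <= f z) ->
  \int[P]_w f (w, Z w) = \int[P]_w \int[P]_w' f (w', Z w).
Proof.
by move=> mf f0; apply: (ge0_integral_independent (X := pastRV)).
Qed.

Lemma random_time_mean (g k : T' -> R) :
  measurable_fun setT g -> measurable_fun setT k -> (forall z, (0 <= k z)%R) ->
  \int[P]_w ((K (g (Z w)) w)%:R * k (Z w))%:E =
  \int[P]_w (M (g (Z w)) * k (Z w))%:E.
Proof.
move=> mg mk k0.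
rewrite (integral_random_time (f := fun z => ((K (g z.2) z.1)%:R * k z.2)%:E)).
- apply: eq_integral => w _ /=.
  under eq_integral do rewrite EFinM muleC.
  rewrite ge0_integralZl ?lee_fin//; last exact/measurable_EFinP/mKt.
  by rewrite K_mean EFinM muleC.
- apply/measurable_EFinP; apply: measurable_funM; first exact: mKtime.
  exact: measurableT_comp.
- by move=> z; rewrite lee_fin mulr_ge0.
Qed.

Lemma random_time_mixed (g1 g2 k : T' -> R) :
  measurable_fun setT g1 -> measurable_fun setT g2 ->
  measurable_fun setT k -> (forall z, (0 <= k z)%R) ->
  \int[P]_w ((K (g1 (Z w)) w)%:R * (K (g2 (Z w)) w)%:R * k (Z w))%:E =
  \int[P]_w ((M (g1 (Z w)) * M (g2 (Z w)) + M (Num.min (g1 (Z w)) (g2 (Z w))))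
              * k (Z w))%:E.
Proof.
move=> mg1 mg2 mk k0.
rewrite (integral_random_time
  (f := fun z => ((K (g1 z.2) z.1)%:R * (K (g2 z.2) z.1)%:R * k z.2)%:E)).
- apply: eq_integral => w _ /=.
  under eq_integral do rewrite EFinM muleC.
  rewrite ge0_integralZl ?lee_fin//; last first.
    by apply/measurable_EFinP/measurable_funM; exact: mKt.
  by rewrite K_mixed EFinM muleC.
- apply/measurable_EFinP; apply: measurable_funM.
    by apply: measurable_funM; exact: mKtime.
  exact: measurableT_comp.
- by move=> z; rewrite lee_fin !mulr_ge0.
Qed.

End random_times.

Section random_time_covariance.
Local Open Scope ereal_scope.
Context d d' (T : measurableType d) (T' : measurableType d') (R : realType)
  (P : probability T R) (Z : {mfun T >-> T'}).

Lemma is_cond_expectation_comp (X : T -> R) (f : T' -> R) :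
  measurable_fun setT f -> P.-integrable setT (EFin \o (f \o Z)) ->
  (forall C, measurable C -> \int[P]_w (f (Z w) * \1_C (Z w))%:E =
                             \int[P]_w (X w * \1_C (Z w))%:E) ->
  is_cond_expectation P Z X (f \o Z).
Proof.
move=> mf fi Xf; split => //.
  move=> B mB; exists (f @^-1` B); last by rewrite setTI.
  by rewrite -[X in measurable X]setTI; exact: mf.
move=> A [C mC <-]; rewrite setTI.
have restrict (h : T -> R) :
    \int[P]_(w in Z @^-1` C) (h w)%:E = \int[P]_w (h w * \1_C (Z w))%:E.
  rewrite integral_mkcond; apply: eq_integral => w _; rewrite patchE indicE.
  have -> : (w \in Z @^-1` C) = (Z w \in C) by apply/idP/idP; rewrite !inE.
  by case: ifP => _; rewrite ?mulr1 ?mulr0.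
by rewrite restrict Xf// restrict.
Qed.

(** The product is dominated by f ^ 2 + g ^ 2. *)
Lemma integrable_mul_sqr (f g : T -> R) :
  measurable_fun setT f -> measurable_fun setT g ->
  P.-integrable setT (EFin \o (f \* f)%R) ->
  P.-integrable setT (EFin \o (g \* g)%R) ->
  P.-integrable setT (EFin \o (f \* g)%R).
Proof.
move=> mf mg ff gg; have ffgg := integrableD measurableT ff gg.
apply: le_integrable ffgg => //.
  by apply/measurable_EFinP; exact: measurable_funM.
move=> w _ /=; rewrite lee_fin.
rewrite [leRHS]ger0_norm ?addr_ge0 -?expr2 ?sqr_ge0//.
by rewrite ler_norml; have := sqr_ge0 (f w + g w)%R; have := sqr_ge0 (f w - g w)%R; nra.
Qed.

Lemma integrable_of_sqr (f : T -> R) : measurable_fun setT f ->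
  P.-integrable setT (EFin \o (f \* f)%R) -> P.-integrable setT (EFin \o f).
Proof.
move=> mf ff.
have one : P.-integrable setT (EFin \o ((cst 1 : T -> R) \* cst 1)%R).
  by rewrite [X in EFin \o X](_ : _ = cst 1%R); [exact: finite_measure_integrable_cst|
     apply/funext => w /=; rewrite mulr1].
have := integrable_mul_sqr mf (@measurable_cst _ _ _ _ setT (1%R : R)) ff one.
by apply: eq_integrable => // w _ /=; rewrite mulr1.
Qed.

Context (K : R -> T -> nat) (M : R -> R).
Hypotheses (mK : forall t, (0 <= t)%R -> measurable_fun setT (K t))
  (K_paths : forall w, increasing_cadlag_from0 (fun t => (K t w)%:R : R))
  (K0 : forall t w, (t <= 0)%R -> K t w = 0%N)
  (K_Z_independent : forall A C, process_sigma K A -> measurable C ->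
     P (A `&` Z @^-1` C) = P A * P (Z @^-1` C)).
Hypotheses (M0 : forall t, (0 <= M t)%R) (mM : measurable_fun setT M)
  (K_mean : forall a, \int[P]_w ((K a w)%:R)%:E = (M a)%:E)
  (K_mixed : forall a b, \int[P]_w ((K a w)%:R * (K b w)%:R)%:E =
     (M a * M b + M (Num.min a b))%:E).

Local Notation counted g := (fun w => (K (g (Z w)) w)%:R : R).
Local Notation mean g := (M \o g \o Z).

Let mC g : measurable_fun setT g -> measurable_fun setT (counted g).
Proof. exact: measurable_random_time. Qed.

Let mMg (g : T' -> R) : measurable_fun setT g -> measurable_fun setT (M \o g).
Proof. by move=> mg; exact: measurableT_comp. Qed.

Let mMean (g : T' -> R) : measurable_fun setT g -> measurable_fun setT (mean g).
Proof. by move=> mg; apply: measurableT_comp => //; exact: measurableT_comp. Qed.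

(** Taking both random times equal in [random_time_mixed], the second moment of
    the count is that of its mean plus the mean itself. *)
Lemma integrable_counted_sqr g : measurable_fun setT g ->
  P.-integrable setT (EFin \o (mean g \* mean g)%R) ->
  P.-integrable setT (EFin \o (counted g \* counted g)%R).
Proof.
move=> mg M2; have M1 := integrable_of_sqr (mMean mg) M2.
apply/integrableP; split.
  by apply/measurable_EFinP; apply: measurable_funM; exact: mC.
have /integrableP[_] := integrableD measurableT M2 M1; apply: le_lt_trans.
rewrite le_eqVlt; apply/orP; left; apply/eqP.
transitivity (\int[P]_w ((K (g (Z w)) w)%:R * (K (g (Z w)) w)%:R * 1)%:E).
  by apply: eq_integral => w _ /=; rewrite mulr1 ger0_norm// mulr_ge0.
rewrite (random_time_mixed mK K_paths K0 K_Z_independent K_mixed (k := cst 1%R))//.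
apply: eq_integral => w _ /=.
by rewrite mulr1 minxx ger0_norm// addr_ge0// mulr_ge0.
Qed.

(** The law of total covariance for X = K (g Z), Y = K (h Z), U = M (g Z),
    V = M (h Z) and W = M (min (g Z) (h Z)); its measurability and integrability
    conditions follow from the second moments of U and V. *)
Theorem random_time_covariance (g h : T' -> R) :
  measurable_fun setT g -> measurable_fun setT h ->
  P.-integrable setT (EFin \o (mean g \* mean g)%R) ->
  P.-integrable setT (EFin \o (mean h \* mean h)%R) ->
  'E_P[cond_covariance P Z (counted g) (counted h)] =
    'E_P[fun w => M (Num.min (g (Z w)) (h (Z w)))] /\
  covariance P (cond_expectation P Z (counted g)) (cond_expectation P Z (counted h)) =
    covariance P (mean g) (mean h) /\
  covariance P (counted g) (counted h) =
    'E_P[fun w => M (Num.min (g (Z w)) (h (Z w)))] + covariance P (mean g) (mean h).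
Proof.
move=> mg mh g2 h2.
have Cg2 := integrable_counted_sqr mg g2; have Ch2 := integrable_counted_sqr mh h2.
have mindic C : measurable C -> measurable_fun setT (\1_C : T' -> R).
  by move=> mC'; exact: measurable_indic.
have meanP := random_time_mean mK K_paths K0 K_Z_independent K_mean.
have mixedP := random_time_mixed mK K_paths K0 K_Z_independent K_mixed.
have XU : is_cond_expectation P Z (counted g) (mean g).
  apply: is_cond_expectation_comp; [exact: mMg|exact: integrable_of_sqr (mMean mg) g2|].
  by move=> C mC'; rewrite meanP//; exact: mindic.
have YV : is_cond_expectation P Z (counted h) (mean h).
  apply: is_cond_expectation_comp; [exact: mMg|exact: integrable_of_sqr (mMean mh) h2|].
  by move=> C mC'; rewrite meanP//; exact: mindic.
have prodP a b : measurable_fun setT a -> measurable_fun setT b ->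
    P.-integrable setT (EFin \o (mean a \* mean a)%R) ->
    P.-integrable setT (EFin \o (mean b \* mean b)%R) ->
    is_cond_expectation P Z (counted a \* mean b)%R (mean a \* mean b)%R.
  move=> ma mb a2 b2; apply: (@is_cond_expectation_comp _ ((M \o a) \* (M \o b))%R).
  - by apply: measurable_funM; exact: mMg.
  - exact: integrable_mul_sqr (mMean ma) (mMean mb) a2 b2.
  - move=> C mC' /=.
    under eq_integral do rewrite -mulrA.
    under [RHS]eq_integral do rewrite -mulrA.
    rewrite (meanP a (fun z => M (b z) * \1_C z)%R)//.
      by apply: measurable_funM; [exact: mMg|exact: mindic].
    by move=> z; rewrite mulr_ge0.
have XV_UV := prodP g h mg mh g2 h2.
have UY_UV : is_cond_expectation P Z (mean g \* counted h)%R (mean g \* mean h)%R.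
  have := prodP h g mh mg h2 g2.
  rewrite [X in is_cond_expectation _ _ X](_ : _ = (mean g \* counted h)%R); last first.
    by apply/funext => w /=; rewrite mulrC.
  rewrite [X in is_cond_expectation _ _ _ X](_ : _ = (mean g \* mean h)%R)//.
  by apply/funext => w /=; rewrite mulrC.
have mmin : measurable_fun setT (fun z => M (Num.min (g z) (h z))).
  by apply: measurableT_comp => //; exact: measurable_minr.
have sW (B : set R) : measurable B -> preimage_set_system [set: T] Z measurable
    ((fun w => M (Num.min (g (Z w)) (h (Z w)))) @^-1` B).
  move=> mB; exists ((fun z => M (Num.min (g z) (h z))) @^-1` B); last by rewrite setTI.
  by rewrite -[X in measurable X]setTI; exact: mmin.
have iW : P.-integrable setT (EFin \o (fun w => M (Num.min (g (Z w)) (h (Z w))))).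
  have iUV1 := integrableD measurableT (integrable_of_sqr (mMean mg) g2)
    (integrable_of_sqr (mMean mh) h2).
  apply: le_integrable iUV1 => //.
    by apply/measurable_EFinP; exact: (measurableT_comp mmin).
  move=> w _ /=; rewrite lee_fin !ger0_norm ?addr_ge0//.
  by have [_|_] := leP (g (Z w)) (h (Z w)); rewrite ?lerDl ?lerDr.
have XY_UVW A : preimage_set_system [set: T] Z measurable A ->
  \int[P]_(w in A) (counted g w * counted h w)%:E =
  \int[P]_(w in A) (mean g w * mean h w + M (Num.min (g (Z w)) (h (Z w))))%:E.
  move=> sA; symmetry; move: A sA; apply: cond_expectation_integral.
  apply: (@is_cond_expectation_comp (counted g \* counted h)%R
    (fun z => M (g z) * M (h z) + M (Num.min (g z) (h z)))%R).
  - by apply: measurable_funD => //; apply: measurable_funM; exact: mMg.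
  - exact: (integrableD measurableT
      (integrable_mul_sqr (mMean mg) (mMean mh) g2 h2) iW).
  - by move=> C mC'; rewrite mixedP//; exact: mindic.
have iX := integrable_of_sqr (mC mg) Cg2.
have iY := integrable_of_sqr (mC mh) Ch2.
have iXV := integrable_mul_sqr (mC mg) (mMean mh) Cg2 h2.
have iUY := integrable_mul_sqr (mMean mg) (mC mh) g2 Ch2.
have iUV := integrable_mul_sqr (mMean mg) (mMean mh) g2 h2.
have iXY := integrable_mul_sqr (mC mg) (mC mh) Cg2 Ch2.
split; [|split].
- exact: expectation_cond_covariance (mC mg) (mC mh) iXY iXV iUY iUV XU YV
    XV_UV UY_UV sW iW XY_UVW.
- exact: covariance_cond_expectation XU YV.
- exact: covariance_total iX iY iXY iUV XU YV iW XY_UVW.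
Qed.

End random_time_covariance.

(** * The fractional non-homogeneous Poisson process *)

Theorem proposition2 (d : measure_display) (T : measurableType d)
    (R : realType) (P : probability T R)
    (alpha : R) (alpha_gt0 : 0 < alpha) (alpha_lt1 : alpha < 1)
    (lambda : R -> R)
    (lambda_ge0 : forall u : R, 0 <= u -> 0 <= lambda u)
    (lambda_integrable : forall s t : R, 0 <= s -> s <= t ->
      lebesgue_measure.-integrable `[s, t] (EFin \o lambda))
    (N1 : R -> {RV P >-> nat}) (N1_poisson : unit_poisson_process N1)
    (L : R -> {RV P >-> R}) (L_stable : stable_subordinator alpha L) :
  let Lambda2 := cumulated_intensity lambda in
  let Lambda := Lambda2 0 in
  let N := fun t w => N1 (Lambda t) w in
  let Y := first_passage L in
  forall (N_Y_independent : independent_processes P N Y)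
    (s t : R) (s_ge0 : 0 <= s) (t_ge0 : 0 <= t)
    (moment_s : ('E_P[fun w => (Lambda (Y s w) ^+ 2)%R] < +oo)%E)
    (moment_t : ('E_P[fun w => (Lambda (Y t w) ^+ 2)%R] < +oo)%E),
  let NYs := fun w => (N (Y s w) w)%:R : R in
  let NYt := fun w => (N (Y t w) w)%:R : R in
  let Z := fun w => (Y s w, Y t w) in
  (covariance P NYs NYt =
    'E_P[cond_covariance P Z NYs NYt] +
    covariance P (cond_expectation P Z NYs) (cond_expectation P Z NYt))%E /\
  ('E_P[cond_covariance P Z NYs NYt] +
    covariance P (cond_expectation P Z NYs) (cond_expectation P Z NYt) =
    'E_P[fun w => Lambda2 0%R (Y (Num.min s t) w)] +
    covariance P (fun w => Lambda (Y s w)) (fun w => Lambda (Y t w)))%E.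
Proof.
move=> Lambda2 Lambda N Y N_Y_independent s t s_ge0 t_ge0 moment_s moment_t NYs NYt Z.
have L_nd w u v : 0 <= u -> u <= v -> L u w <= L v w.
  exact: (path_nondecreasing (subordinator_paths L_stable w)).
have mY u : measurable_fun setT (Y u) by exact: measurable_first_passage.
have mZ : measurable_fun setT Z by exact: measurable_fun_pair.
pose ZRV : {mfun T >-> (R * R)%type} := HB.pack Z (isMeasurableFun.Build _ _ _ _ _ mZ).
have Lambda_path := cumulated_intensity_path lambda_ge0 lambda_integrable.
have Lambda_ge0 u : 0 <= Lambda u by exact: cumulated_intensity_ge0.
have mLambda : measurable_fun setT Lambda by exact: measurable_cumulated_intensity.
have mLY u : measurable_fun setT (fun w => Lambda (Y u w)) by exact: measurableT_comp.
have Lambda_min a b : Lambda (Num.min a b) = Num.min (Lambda a) (Lambda b).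
  have Lambda_nd := cumulated_intensity_nondecreasing lambda_ge0 lambda_integrable.
  have [ab|/ltW ba] := leP a b.
    by rewrite min_l//; exact: Lambda_nd.
  by rewrite min_r//; exact: Lambda_nd.
have mN u : 0 <= u -> measurable_fun setT (N u) by move=> _; exact: measurable_funPT.
have N_path w : increasing_cadlag_from0 (fun u => (N u w)%:R : R).
  exact: increasing_cadlag_comp (poisson_paths N1_poisson w) Lambda_path.
have N0 u w : u <= 0 -> N u w = 0%N.
  move=> u0; rewrite /N /Lambda /Lambda2 cumulated_intensity_le0//.
  exact: (poisson_process0 N1_poisson).
have N_mean a : (\int[P]_w ((N a w)%:R)%:E = (Lambda a)%:E)%E.
  exact: poisson_process_mean.
have N_mixed a b : (\int[P]_w ((N a w)%:R * (N b w)%:R)%:E =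
    (Lambda a * Lambda b + Lambda (Num.min a b))%:E)%E.
  by rewrite Lambda_min; exact: poisson_process_mixed.
have N_Z_independent A C : process_sigma N A -> measurable C ->
    P (A `&` ZRV @^-1` C) = (P A * P (ZRV @^-1` C))%E.
  move=> NA mC; apply: N_Y_independent => //.
  (* Z is measurable already for the sigma-algebra generated by Y. *)
  pose G := \bigcup_(u in [set u : R | 0 <= u])
    preimage_set_system setT (Y u) measurable.
  have mYG u : 0 <= u -> measurable_fun [set: g_sigma_algebraType G] (Y u).
    move=> u0 _ B mB; apply: sub_sigma_algebra; exists u => //; exists B => //.
  have mZG : measurable_fun [set: g_sigma_algebraType G] Z.
    by apply: measurable_fun_pair; exact: mYG.
  by have := mZG measurableT C mC; rewrite setTI.
have sqr_integrable u : ('E_P[fun w => (Lambda (Y u w) ^+ 2)%R] < +oo)%E ->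
    P.-integrable setT (EFin \o ((fun w => Lambda (Y u w))
      \* (fun w => Lambda (Y u w)))%R).
  rewrite unlock => moment; apply/integrableP; split.
    by apply/measurable_EFinP; exact: measurable_funM.
  apply: le_lt_trans moment; rewrite le_eqVlt; apply/orP; left; apply/eqP.
  by apply: eq_integral => w _ /=; rewrite ger0_norm ?expr2// mulr_ge0.
have [ccE [covE totE]] := random_time_covariance (Z := ZRV) mN N_path N0
  N_Z_independent Lambda_ge0 mLambda N_mean N_mixed measurable_fst measurable_snd
  (sqr_integrable s moment_s) (sqr_integrable t moment_t).
have min_Y : ('E_P[fun w => Lambda (Num.min (Y s w) (Y t w))] =
    'E_P[fun w => Lambda2 0%R (Y (Num.min s t) w)])%E.
  rewrite unlock; apply: ae_eq_integral => //.
  - apply/measurable_EFinP; apply: measurableT_comp => //.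
    exact: measurable_minr.
  - exact/measurable_EFinP.
  (* Y is monotone on the almost sure event that levels s and t are passed. *)
  have := stable_subordinator_unbounded L_stable s_ge0.
  have := stable_subordinator_unbounded L_stable t_ge0.
  apply: filterS2 => w t_passed s_passed _; congr (Lambda _)%:E.
  have [st|/ltW ts] := leP s t.
    by rewrite min_l//; exact: first_passage_le.
  by rewrite min_r//; exact: first_passage_le.
split.
- by rewrite [LHS]totE -[in LHS]covE -[in LHS]ccE.
- by rewrite -min_Y; congr (_ + _)%E; [exact: ccE|exact: covE].
Qed.
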